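(* Let $n\ge 9$ with $n\equiv 3\pmod 6$. Then the Bose Construction coupled with the Bose Mapping produces a Steiner triple system of order $n$ with min-sum equal to $n$; that is, $\left([0,n-1],\ \{\pi_B(B): B\in\mathcal{B}'\}\right)$ is a Steiner triple system of order $n$, and the minimum over its blocks of the sum of the elements of the block equals $n$.
   Context: For integers $a\le b$, $[a,b]=\{a,\ldots,b\}$. A Steiner triple system of order $n$ is a pair $(\mathcal{X},\mathcal{B})$ with $|\mathcal{X}|=n$ and $\mathcal{B}$ a collection of 3-subsets (blocks) of $\mathcal{X}$ such that every 2-subset of $\mathcal{X}$ lies in exactly one block. For $\mathcal{X}=[0,n-1]$, the min-sum is $\min_{B\in\mathcal{B}}\sum_{x\in B}x$. Bose Construction: write $n=3m$, $m\ge 3$ odd. For $x,y\in[0,m-1]$ let $x\oplus_b y\in[0,m-1]$ be the residue of $\frac{m+1}{2}(x+y)$ modulo $m$. The point set is $\mathcal{X}'=\{(x,i): x\in[0,m-1],\ i\in[0,2]\}$, and the block set $\mathcal{B}'$ consists of: (Type 1) $B_x=\{(x,0),(x,1),(x,2)\}$ for $x\in[0,m-1]$; (Type 2) $B_{x,y,i}=\{(x,i),(y,i),(x\oplus_b y,\ i+1 \bmod 3)\}$ for $0\le x<y\le m-1$ and $i\in[0,2]$. Bose Mapping $\pi_B:\mathcal{X}'\to[0,n-1]$: for $x\in[0,m-1]$, $\pi_B((x,0))=x$; $\pi_B((x,1))=2m$ if $x=0$, and $\pi_B((x,1))=n-y$ if $x\ne0$, where $y$ is the unique element of $[0,m-1]$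 with $x=0\oplus_b y$; $\pi_B((x,2))=m$ if $x=0$, and $\pi_B((x,2))=m+\big(0\oplus_b(m-x)\big)$ if $x\neq 0$. The mapping is applied to each point of each block. *)

(* Defs.v *)
From HB Require Import structures.
From mathcomp Require Import all_boot.
From mathcomp Require Import finmap.

Set Implicit Arguments.
Unset Strict Implicit.
Unset Printing Implicit Defensive.

Local Open Scope fset_scope.
Local Open Scope nat_scope.

Definition interval0 (n : nat) : {fset nat} := [fset x in iota 0 n].

Definition steiner_triple_system (K : choiceType) (n : nat)
    (X : {fset K}) (B : {fset {fset K}}) : Prop :=
  [/\ #|` X| = n,
      forall b : {fset K}, b \in B -> b `<=` X /\ #|` b| = 3
    & forall e : {fset K}, e `<=` X -> #|` e| = 2 ->
        exists! b : {fset K}, b \in B /\ e `<=` b].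

Definition block_sum (b : {fset nat}) : nat := \sum_(x <- b) x.

Definition is_min_sum (B : {fset {fset nat}}) (s : nat) : Prop :=
  (exists2 b, b \in B & block_sum b = s) /\
  (forall b, b \in B -> s <= block_sum b).

(* Used for odd m only, so that m.+1./2 is exactly (m + 1) / 2. *)
Definition bose_op (m x y : nat) : nat := (m.+1./2 * (x + y)) %% m.

Definition bose_points (m : nat) : {fset nat * nat} :=
  [fset ((x, i) : nat * nat) | x in interval0 m, i in interval0 3].

Definition bose_block1 (x : nat) : {fset nat * nat} :=
  [fset (x, 0); (x, 1); (x, 2)].

Definition bose_block2 (m x y i : nat) : {fset nat * nat} :=
  [fset (x, i); (y, i); (bose_op m x y, i.+1 %% 3)].

Definition bose_blocks (m : nat) : {fset {fset nat * nat}} :=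
  [fset bose_block1 x | x in interval0 m] `|`
  [fset bose_block2 m p.1 y p.2 |
     p in bose_points m, y in interval0 m & p.1 < y].

(* The y in [0, m - 1] such that x = bose_op m 0 y, found by search; its
   existence and uniqueness for odd m are bose_preimP and bose_preim_uniq. *)
Definition bose_preim (m x : nat) : nat :=
  find (fun y => x == bose_op m 0 y) (iota 0 m).

Lemma bose_opK (m y : nat) : odd m -> y < m -> (bose_op m 0 y).*2 = y %[mod m].
Proof.
move=> om ym; rewrite /bose_op add0n -muln2 modnMml mulnAC muln2.
have -> : m.+1./2.*2 = m.+1 by rewrite even_halfK //= om.
by rewrite mulSn addnC (mulnC m) modnMDl.
Qed.

Lemma bose_preim_uniq (m y z : nat) : odd m -> y < m -> z < m ->
  bose_op m 0 y = bose_op m 0 z -> y = z.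
Proof.
move=> om ym zm e; rewrite -(modn_small ym) -(modn_small zm).
by rewrite -(bose_opK om ym) -(bose_opK om zm) e.
Qed.

Lemma bose_preimP (m x : nat) : odd m -> x < m ->
  bose_preim m x < m /\ x = bose_op m 0 (bose_preim m x).
Proof.
move=> om xm.
have m0 : 0 < m by case: (m) xm.
have h : has (fun y => x == bose_op m 0 y) (iota 0 m).
  apply/hasP; exists (x.*2 %% m); first by rewrite mem_iota /= ltn_mod.
  rewrite /bose_op add0n modnMmr -mul2n mulnCA mulnA mul2n.
  rewrite even_halfK /= ?om // mulSn addnC (mulnC m) modnMDl.
  by rewrite modn_small.
have hl : bose_preim m x < m by move: h; rewrite has_find size_iota.
by split=> //; have /eqP := nth_find 0 h; rewrite nth_iota.
Qed.

(* A point (x, i) is sent into [0, n - 1] with n = 3 * m; only i < 3 matters,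
   and every i >= 2 falls in the last branch. *)
Definition bose_map (m : nat) (p : nat * nat) : nat :=
  let: (x, i) := p in
  match i with
  | 0 => x
  | 1 => if x == 0 then 2 * m else 3 * m - bose_preim m x
  | _ => if x == 0 then m else m + bose_op m 0 (m - x)
  end.

Definition bose_mapped_blocks (m : nat) : {fset {fset nat}} :=
  [fset bose_map m @` b | b : {fset nat * nat} in bose_blocks m].

(* Main.v *)
(* With t (x, 1) and t (x, 2) the values of the mapping, t (x, 1) = 3m - a
   where 0 < a <= m and a = 2x mod m, and t (x, 2) = m + w where 0 <= w < m and
   2w = -x mod m. Hence the mapping is a bijection onto [0, 3m - 1], and it
   suffices that the Bose construction is a Steiner system, which holds because
   any two points determine the third point of their block. On a block
   (x, 0), (y, 0), (z, 1) with 2z = x + y mod m the sum is 3m + x + y - a with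
   a = x + y mod m, so a <= x + y as x + y > 0; on (x, 2), (y, 2), (z, 0) it is
   2m + (w + w' + z) with w + w' + z a positive multiple of m; the other blocks
   are at least as large, and the block of x = 0 attains 0 + 2m + m. *)
Require Import Defs.
From mathcomp Require Import all_boot.
From mathcomp Require Import finmap.
From mathcomp Require Import zify.

Set Implicit Arguments.
Unset Strict Implicit.
Unset Printing Implicit Defensive.

Local Open Scope fset_scope.
Local Open Scope nat_scope.

(* Residues modulo [m] are spelled out as equations so that [lia] applies. *)
Lemma bose_opP m x y : odd m -> x < m -> y < m ->
  bose_op m x y < m /\
  [\/ 2 * bose_op m x y = x + y, 2 * bose_op m x y = x + y + m
    | 2 * bose_op m x y + m = x + y].
Proof.
move=> om xm ym.
have um : bose_op m x y < m by rewrite /bose_op ltn_mod; lia.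
split=> //.
have : 2 * bose_op m x y = x + y %[mod m].
  rewrite /bose_op modnMmr mulnA mul2n even_halfK /= ?om //.
  by rewrite mulSn addnC (mulnC m) modnMDl.
move: (bose_op m x y) um => u um /eqP.
(* Subtraction on [nat] is truncated, so the congruence is oriented by the larger side. Both sides
   lie below [2 * m], hence they differ by [k * m] with [k < 2]. *)
have [le|/ltnW le] := leqP (x + y) (2 * u); last rewrite eq_sym.
all: rewrite eqn_mod_dvd // => /dvdnP[k hk].
all: have : k < 2 by nia.
all: case: k hk => [|[|k]] // hk _; [constructor 1|]; try lia.
by constructor 2; lia.
by constructor 3; lia.
Qed.

(** * Membership in the point and block sets *)

Lemma mem_interval0 n x : (x \in interval0 n) = (x < n).
Proof. by rewrite !inE /= mem_iota. Qed.

Lemma mem_bose_points m x i : ((x, i) \in bose_points m) = (x < m) && (i < 3).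
Proof.
apply/imfset2P/andP => [[a /= ha [b /= hb [-> ->]]]|[xm im]].
  by move: ha hb; rewrite !mem_interval0.
by exists x; rewrite /= ?mem_interval0 //; exists i; rewrite ?mem_interval0.
Qed.

Lemma bose_blocksP m b : reflect
  ((exists2 x, x < m & b = bose_block1 x) \/
   (exists x y i, [/\ x < y, y < m, i < 3 & b = bose_block2 m x y i]))
  (b \in bose_blocks m).
Proof.
rewrite /bose_blocks in_fsetU.
apply: (iffP orP) => -[].
- by case/imfsetP=> x /=; rewrite mem_interval0 => xm ->; left; exists x.
- case/imfset2P=> -[x i] /=; rewrite mem_bose_points => /andP[xm im] [y].
  rewrite !inE /= mem_iota => /andP[ym xy] ->; right; exists x, y, i.
  by split.
- case=> x xm ->; left; apply/imfsetP; exists x => //=.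
  by rewrite mem_interval0.
- case=> x [y [i [xy ym im ->]]]; right; apply/imfset2P.
  exists (x, i) => /=; first by rewrite mem_bose_points im (ltn_trans xy ym).
  by exists y => //; rewrite !inE /= mem_iota ym.
Qed.

(** * Sets with two or three elements *)

Lemma fset3_rot (K : choiceType) (a b c : K) : [fset a; b; c] = [fset b; c; a].
Proof. by rewrite -fsetUA fsetUC. Qed.

Lemma fset3_swap (K : choiceType) (a b c : K) : [fset a; b; c] = [fset b; a; c].
Proof. by rewrite (fsetUC [fset a]). Qed.

Lemma cardfs3 (K : choiceType) (a b c : K) :
  a != b -> a != c -> b != c -> #|` [fset a; b; c]| = 3.
Proof.
by move=> ab ac bc; rewrite -fsetUA cardfsU1 cardfs2 !inE negb_or ab ac bc.
Qed.

Lemma big_fset3 (K : choiceType) (F : K -> nat) (a b c : K) :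
  a != b -> a != c -> b != c ->
  \sum_(x <- [fset a; b; c]) F x = F a + F b + F c.
Proof.
move=> ab ac bc; rewrite -fsetUA big_fsetU1 ?inE ?negb_or ?ab //=.
by rewrite big_fsetU1 ?inE //= big_seq_fset1 addnA.
Qed.

Lemma cardfs2P (K : choiceType) (e : {fset K}) :
  #|` e| = 2 -> exists p q, p != q /\ e = [fset p; q].
Proof.
move=> e2; have /fset0Pn[p pe] : e != fset0 by rewrite -cardfs_eq0 e2.
move: e2; rewrite (cardfsD1 p) pe add1n => -[/eqP/cardfs1P[q eq]].
exists p, q; split; last by rewrite -eq fsetD1K.
have : q \in e `\ p by rewrite eq inE.
by rewrite !inE eq_sym => /andP[].
Qed.

(** * Steiner systems: a criterion and transport along injections *)

(** A block that can be rebuilt from any two of its points is the only block through them, so a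
    third-point function gives existence and uniqueness at once. *)
Lemma steiner_of_third (K : choiceType) n (X : {fset K}) B (third : K -> K -> K) :
    #|` X| = n ->
    (forall b, b \in B -> b `<=` X /\ #|` b| = 3) ->
    {in X &, forall p q, p != q -> [fset p; q; third p q] \in B} ->
    (forall b, b \in B ->
      {in b &, forall p q, p != q -> b = [fset p; q; third p q]}) ->
  steiner_triple_system n X B.
Proof.
move=> Xn B3 ex uni; split=> // e eX /cardfs2P[p [q [pq def_e]]]; subst e.
move: eX; rewrite fsubUset !fsub1set => /andP[pX qX].
exists [fset p; q; third p q]; split; first by rewrite ex // fsubsetUl.
move=> b [bB]; rewrite fsubUset !fsub1set => /andP[pb qb].
by rewrite -(uni b).
Qed.

Lemma steiner_imfset (K L : choiceType) (f : K -> L) n (X : {fset K})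
    (B : {fset {fset K}}) : {in X &, injective f} ->
  steiner_triple_system n X B ->
  steiner_triple_system n (f @` X) [fset f @` b | b : {fset K} in B].
Proof.
move=> fI [Xn B3 B1].
have card_f (Y : {fset K}) : Y `<=` X -> #|` f @` Y| = #|` Y|.
  by move=> /fsubsetP YX; rewrite card_in_imfset // => p q /YX pX /YX; apply: fI.
split; first by rewrite card_f.
  move=> _ /imfsetP[b /= /B3[bX b3] ->]; split.
    exact/subset_imfset/fsubsetP.
  by rewrite card_f.
move=> e eX e2; pose e' := [fset x in X | f x \in e].
have e'X : e' `<=` X by apply/fsubsetP=> x; rewrite !inE /= => /andP[].
have def_e : e = f @` e'.
  apply/fsetP=> z; apply/idP/imfsetP => [ze|[x /=]].
    have /imfsetP[x /= xX zx] := fsubsetP eX z ze.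
    by exists x; rewrite //= !inE /= xX -zx.
  by rewrite !inE => /andP[_ xe] ->.
have sub_e (b : {fset K}) : b `<=` X -> (e `<=` f @` b) = (e' `<=` b).
  move=> bX; apply/idP/idP => [|/fsubsetP eb]; last first.
    by rewrite def_e; apply: subset_imfset.
  move=> /fsubsetP eb; apply/fsubsetP=> x; rewrite !inE => /andP[xX /eb].
  by case/imfsetP=> y /= yb /fI -> //; apply: (fsubsetP bX).
have e'2 : #|` e'| = 2 by rewrite -e2 def_e card_f.
have [b [[bB eb] uni]] := B1 e' e'X e'2.
exists (f @` b); split.
  by rewrite in_imfset // sub_e //; have [] := B3 b bB.
move=> _ [/imfsetP[c /= cB ->]]; rewrite sub_e; last by have [] := B3 c cB.
by move=> ec; rewrite (uni c).
Qed.

(* Reduces [2 * u - x] modulo [m], which solves [bose_op m x v = u] for [v]. *)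
Definition bose_reflect m x u :=
  if 2 * u < x then 2 * u + m - x
  else if 2 * u - x < m then 2 * u - x else 2 * u - x - m.

Lemma bose_reflectP m x u : x < m -> u < m ->
  bose_reflect m x u < m /\
  [\/ bose_reflect m x u + x = 2 * u, bose_reflect m x u + x = 2 * u + m
    | bose_reflect m x u + x + m = 2 * u].
Proof.
move=> xm um; rewrite /bose_reflect; case: ifP => [?|?].
  by split; [lia | constructor 2; lia].
case: ifP => ?; split; try lia; [constructor 1|constructor 3]; lia.
Qed.

(** Both sides are congruent modulo [m] and below [m]. With [bose_op_reflect], this makes
    [bose_op m x] a permutation of the residues with inverse [bose_reflect m x]. *)
Lemma bose_reflect_op m x y : odd m -> x < m -> y < m ->
  bose_reflect m x (bose_op m x y) = y.
Proof.
move=> om xm ym; have [um ue] := bose_opP om xm ym.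
by have [vm ve] := bose_reflectP xm um; case: ue => ?; case: ve => ?; lia.
Qed.

Lemma bose_op_reflect m x u : odd m -> x < m -> u < m ->
  bose_op m x (bose_reflect m x u) = u.
Proof.
move=> om xm um; have [vm ve] := bose_reflectP xm um.
have [wm we] := bose_opP om xm vm.
by case: ve => ?; case: we => ?; lia.
Qed.

Lemma bose_opC m x y : bose_op m x y = bose_op m y x.
Proof. by rewrite /bose_op addnC. Qed.

Lemma bose_opxx m x : odd m -> x < m -> bose_op m x x = x.
Proof. by move=> om xm; have [um []] := bose_opP om xm xm; lia. Qed.

(** The operation is idempotent and cancellative: a value [x] at [y] would equal the value at [x]
    and force [y = x]. *)
Lemma bose_op_neq m x y : odd m -> x < m -> y < m -> x != y ->
  bose_op m x y != x.
Proof.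
move=> om xm ym; apply: contra => /eqP e.
have := bose_reflect_op om xm xm; rewrite bose_opxx // -{2}e.
by rewrite bose_reflect_op // => ->.
Qed.

(** * The Bose construction as a Steiner triple system *)

(** On a Type 1 block the levels sum to 3, which gives the missing one. In the last two branches one
    point lies on the level following the other, so it is the [bose_op] value and the missing
    argument is recovered by reflection. *)
Definition bose_third m (p q : nat * nat) : nat * nat :=
  if p.2 == q.2 then (bose_op m p.1 q.1, p.2.+1 %% 3)
  else if p.1 == q.1 then (p.1, 3 - (p.2 + q.2))
  else if q.2 == p.2.+1 %% 3 then (bose_reflect m p.1 q.1, p.2)
  else (bose_reflect m q.1 p.1, q.2).

Lemma bose_block2_in m x y i : x < m -> y < m -> i < 3 -> x != y ->
  bose_block2 m x y i \in bose_blocks m.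
Proof.
move=> xm ym im; rewrite neq_ltn => /orP[xy|yx]; apply/bose_blocksP; right.
  by exists x, y, i.
by exists y, x, i; split=> //; rewrite /bose_block2 fset3_swap bose_opC.
Qed.

Lemma bose_third_in m : odd m -> {in bose_points m &, forall p q, p != q ->
  [fset p; q; bose_third m p q] \in bose_blocks m}.
Proof.
move=> om [x i] [y j]; rewrite !mem_bose_points => /andP[xm i3] /andP[ym j3].
rewrite xpair_eqE /bose_third /=; case: (altP (i =P j)) => [<-|ij] /=.
  by rewrite andbT; apply: bose_block2_in.
case: (altP (x =P y)) => [<- _|xy _].
  apply/bose_blocksP; left; exists x => //; rewrite /bose_block1.
  by case: i i3 j j3 ij => [|[|[|]]] // _ [|[|[|]]] //= _ _;
    apply/fsetP=> z; rewrite !inE;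
    case: (z == (x, 0)); case: (z == (x, 1)); case: (z == (x, 2)).
have aux u v k l : u < m -> v < m -> k < 3 -> l = k.+1 %% 3 -> u != v ->
    [fset (u, k); (v, l); (bose_reflect m u v, k)] \in bose_blocks m.
  move=> um vm k3 -> uv; have [wm _] := bose_reflectP um vm.
  rewrite fset3_swap fset3_rot.
  have := bose_block2_in um wm k3; rewrite /bose_block2 bose_op_reflect //; apply.
  apply: contra uv => /eqP uw.
  by rewrite -(bose_op_reflect om um vm) -uw bose_opxx.
case: eqP => ji; first exact: aux.
(* Two distinct levels modulo 3 are successive in one of the two orders. *)
by rewrite fset3_swap; apply: aux; rewrite // 1?eq_sym //; lia.
Qed.

Lemma bose_third_uniq m b : odd m -> b \in bose_blocks m ->
  {in b &, forall p q, p != q -> b = [fset p; q; bose_third m p q]}.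
Proof.
move=> om /bose_blocksP[[x xm ->]|[x [y [i [xy ym i3 ->]]]]] p q.
  rewrite !inE -!orbA => /or3P[]/eqP-> /or3P[]/eqP->;
    rewrite ?eqxx // /bose_third /= eqxx /= => _;
    apply/fsetP=> z; rewrite !inE;
    by case: (z == (x, 0)); case: (z == (x, 1)); case: (z == (x, 2)).
have xm := ltn_trans xy ym; have xNy : x != y by rewrite neq_ltn xy.
have [um _] := bose_opP om xm ym.
have ux := bose_op_neq om xm ym xNy.
have uy : bose_op m x y != y by rewrite bose_opC bose_op_neq // eq_sym.
have ii : (i == i.+1 %% 3) = false by case: i i3 => [|[|[|]]].
(* Rules out the third branch of [bose_third] when the point on the higher level, cyclically, is
   listed first. *)
have ii2 : (i == (i.+1 %% 3).+1 %% 3) = false by case: i i3 {ii} => [|[|[|]]].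
have ry : bose_reflect m y (bose_op m x y) = x by rewrite bose_opC bose_reflect_op.
have rx := bose_reflect_op om xm ym.
rewrite /bose_block2 !inE -!orbA => /or3P[]/eqP-> /or3P[]/eqP->;
  rewrite ?eqxx // /bose_third /= ?eqxx /= => _;
  rewrite ?(eq_sym _ i) ?ii ?ii2 ?(negPf ux) ?(negPf uy) ?(eq_sym x)
    ?(eq_sym y) ?(negPf ux) ?(negPf uy) ?eqxx ?rx ?ry ?(bose_opC _ y x) //;
  apply/fsetP=> z; rewrite !inE;
  by case: (z == (x, i)); case: (z == (y, i));
    case: (z == (bose_op m x y, i.+1 %% 3)).
Qed.

Lemma card_interval0 n : #|` interval0 n| = n.
Proof. by rewrite card_fseq undup_id ?iota_uniq ?size_iota. Qed.

Lemma card_bose_points m : #|` bose_points m| = 3 * m.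
Proof.
have -> : bose_points m = [fset p in allpairs pair (iota 0 m) (iota 0 3)].
  apply/fsetP=> -[x i]; rewrite mem_bose_points in_fset.
  rewrite [in_mem _ _]/(_ \in allpairs _ _ _).
  apply/andP/allpairsP => [[xm i3]|[[y j] [/= ym j3 [-> ->]]]].
    by exists (x, i); rewrite !mem_iota.
  by move: ym j3; rewrite mem_iota !inE => /andP[_ ->]; case: j => [|[|[|]]].
rewrite card_fseq undup_id ?size_allpairs ?size_iota 1?mulnC //.
by apply: allpairs_uniq; rewrite ?iota_uniq // => -[? ?] [? ?].
Qed.

Lemma bose_steiner m : odd m ->
  steiner_triple_system (3 * m) (bose_points m) (bose_blocks m).
Proof.
move=> om; apply: (steiner_of_third (card_bose_points m) (third := bose_third m)).
- move=> b /bose_blocksP[[x xm ->]|[x [y [i [xy ym i3 ->]]]]].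
    split; last by rewrite cardfs3 // xpair_eqE eqxx.
    by rewrite !fsubUset !fsub1set !mem_bose_points xm.
  have xm := ltn_trans xy ym; have [um _] := bose_opP om xm ym.
  rewrite !fsubUset !fsub1set !mem_bose_points xm ym i3 um ltn_mod; split=> //.
  have ii : i == i.+1 %% 3 = false by case: i i3 => [|[|[|]]].
  by rewrite cardfs3 // xpair_eqE ?ii ?andbF ?negb_and ?neq_ltn ?xy.
- exact: bose_third_in.
- by move=> b; apply: bose_third_uniq.
Qed.


(** * The Bose mapping as a bijection *)

(** Taking the residue of [2 * x] in [[1, m]] rather than [[0, m - 1]] absorbs the exceptional value
    at [x = 0], the only point where the third alternative occurs. *)
Lemma bose_map1P m x : odd m -> x < m ->
  exists y, [/\ bose_map m (x, 1) = 3 * m - y, 0 < y <= m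
    & [\/ y = 2 * x, y + m = 2 * x | y = 2 * x + m]].
Proof.
move=> om xm; rewrite /bose_map; case: eqP => [->|/eqP x0].
  by exists m; split; [lia | lia | constructor 3; lia].
have [ym def_x] := bose_preimP om xm; exists (bose_preim m x).
have m0 : 0 < m by lia.
have [_] := bose_opP om m0 ym; rewrite -def_x.
(* A zero preimage would give [2 * x = 0] or [2 * x = m], against [x != 0] and [m] odd. *)
by case=> ?; split=> //; try lia; [constructor 1 | constructor 2]; lia.
Qed.

Lemma bose_map2P m x : odd m -> x < m ->
  exists w, [/\ bose_map m (x, 2) = m + w, w < m
    & [\/ x + 2 * w = 0, x + 2 * w = m | x + 2 * w = 2 * m]].
Proof.
move=> om xm; rewrite /bose_map; case: eqP => [->|/eqP x0].
  by exists 0; split; [lia | lia | constructor 1].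
exists (bose_op m 0 (m - x)).
have m0 : 0 < m by lia.
have xm' : m - x < m by lia.
have [wm we] := bose_opP om m0 xm'; split=> //.
(* The last case, [2 * w + m = m - x], would force [x = 0]. *)
by case: we => ?; [constructor 2 | constructor 3 | ]; lia.
Qed.

(** Levels 0, 2, 1 land in the disjoint intervals [[0, m - 1]], [[m, 2m - 1]], [[2m, 3m - 1]].
    Within level 1 the value fixes [2 * x] modulo the odd [m]; within level 2 it fixes [x] modulo
    [m]. *)
Lemma bose_map_inj m : odd m -> {in bose_points m &, injective (bose_map m)}.
Proof.
move=> om [x i] [y j]; rewrite !mem_bose_points => /andP[xm i3] /andP[ym j3].
have [a [ax am ae]] := bose_map1P om xm; have [b [bx bm be]] := bose_map1P om ym.
have [c [cx cm ce]] := bose_map2P om xm; have [d [dx dm de]] := bose_map2P om ym.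
have [ex ey] : bose_map m (x, 0) = x /\ bose_map m (y, 0) = y by [].
case: i i3 => [|[|[|]]] // _; case: j j3 => [|[|[|]]] // _;
  rewrite ?ax ?bx ?cx ?dx ?ex ?ey => e; try lia.
- by rewrite e.
- by congr pair; case: ae => ?; case: be => ?; lia.
- by congr pair; case: ce => ?; case: de => ?; lia.
Qed.

Lemma bose_map_lt m x i : odd m -> x < m -> i < 3 -> bose_map m (x, i) < 3 * m.
Proof.
move=> om xm; have [a [ax am _]] := bose_map1P om xm.
have [c [cx cm _]] := bose_map2P om xm.
have ex : bose_map m (x, 0) = x by [].
by case: i => [|[|[|]]] // _; rewrite ?ax ?cx ?ex; lia.
Qed.

(** Surjectivity comes from counting: the image lies in the interval and both have [3 * m]
    elements. *)
Lemma bose_map_imfset m : odd m ->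
  bose_map m @` bose_points m = interval0 (3 * m).
Proof.
move=> om; apply/eqP; rewrite eqEfcard card_interval0 card_in_imfset /=; last first.
  exact: bose_map_inj.
rewrite card_bose_points leqnn andbT; apply/fsubsetP=> _ /imfsetP[[x i] /= + ->].
by rewrite mem_bose_points mem_interval0 => /andP[]; apply: bose_map_lt.
Qed.

(** * Block sums and the minimum *)

Lemma bose_map_block_ge m b : odd m -> b \in bose_blocks m ->
  3 * m <= \sum_(p <- b) bose_map m p.
Proof.
move=> om /bose_blocksP[[x xm ->]|[x [y [i [xy ym i3 ->]]]]].
  rewrite big_fset3 ?xpair_eqE ?eqxx //.
  have [a [-> am ae]] := bose_map1P om xm; have [c [-> cm ce]] := bose_map2P om xm.
  have -> : bose_map m (x, 0) = x by [].
  by case: ae => ?; case: ce => ?; lia.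
have xm := ltn_trans xy ym; have [um ue] := bose_opP om xm ym.
have ii : i == i.+1 %% 3 = false by case: i i3 => [|[|[|]]].
rewrite big_fset3 ?xpair_eqE ?ii ?andbF ?negb_and ?neq_ltn ?xy //.
have [a [ax am ae]] := bose_map1P om xm; have [b' [bx bm be]] := bose_map1P om ym.
have [c [cx cm ce]] := bose_map2P om xm; have [d [dx dm de]] := bose_map2P om ym.
have [e [ux em ee]] := bose_map1P om um.
have [f [vx fm fe]] := bose_map2P om um.
have e0 z : bose_map m (z, 0) = z by [].
case: i {ii} i3 => [|[|[|]]] // _.
- rewrite !e0 modn_small // ux; by case: ue => ?; case: ee => ?; lia.
(* Here size alone suffices: two terms are at least [2 * m] and the third at least [m]. *)
- rewrite ax bx modn_small // vx; lia.
(* The multiple of [m] given by [c + d + bose_op m x y] is nonzero, since [c = d = 0] would force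
   [x = y = 0], against [x < y]. *)
- rewrite cx dx modnn e0.
  by case: ue => ?; case: ce => ?; case: de => ?; lia.
Qed.

Theorem theorem1 (n m : nat) (hn : 9 <= n) (hn6 : n = 3 %[mod 6])
    (hm : n = 3 * m) :
  steiner_triple_system n (interval0 n) (bose_mapped_blocks m) /\
  is_min_sum (bose_mapped_blocks m) n.
Proof.
have om : odd m by lia.
have m0 : 0 < m by lia.
subst n; split.
  rewrite -bose_map_imfset //.
  exact: (steiner_imfset (bose_map_inj om) (bose_steiner om)).
(* Injectivity on the block ensures that no two points merge in the image, so the sum can be taken
   over the points. *)
have sum_map b : b \in bose_blocks m ->
    block_sum (bose_map m @` b) = \sum_(p <- b) bose_map m p.
  move=> bB; have [_ /(_ b bB)[/fsubsetP bX _] _] := bose_steiner om.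
  rewrite /block_sum big_imfset //= => p q /bX pX /bX qX.
  exact: (bose_map_inj om).
split; last first.
  by move=> _ /imfsetP[b /= bB ->]; rewrite sum_map // bose_map_block_ge.
have b0 : bose_block1 0 \in bose_blocks m by apply/bose_blocksP; left; exists 0.
exists (bose_map m @` bose_block1 0); first exact: in_imfset.
by rewrite sum_map // big_fset3 //= mulSn; lia.
Qed.
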